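(* Let $k, \ell$ be integers with $0 \le \ell \le k$, and let $H_k$ be the approximation of $J_k^{-1}$ constructed by $\ell$ Broyden ''bad'' updates $$ H_{j+1} = H_j V_j + \frac{s_j y_j^T}{\rho_j}, \qquad j = k-\ell, \dots, k-1, $$ using the initial approximation $H_{k-\ell} = J_{k-\ell}^{-1}$. Given $v \in \mathbb{R}^{2n+m}$, the computation of $r = H_k v$ is equivalent to the solution of the linear system $$ J_{k-\ell}\, r = v + \begin{bmatrix} 0 \\ 0 \\ \displaystyle\sum_{i=1}^{\ell} \alpha_i \left( Z^{k-\ell} s_{k-i,x} + X^{k-\ell} s_{k-i,z} - y_{k-i,\mu} \right) \end{bmatrix} $$ (that is, $r = H_k v$ if and only if $r$ solves this system), where $$ \alpha_i = \frac{y_{k-i}^T \left(\prod_{j=k-i+1}^{k-1} V_j\right) v}{\rho_{k-i}}, \qquad i = 1,\dots,\ell. $$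
   Context: Let $Q \in \mathbb{R}^{n\times n}$, $A \in \mathbb{R}^{m\times n}$ with linearly independent rows, $b \in \mathbb{R}^m$, $c \in \mathbb{R}^n$ be the data of the quadratic program $\min \frac12 x^TQx + c^Tx$ subject to $Ax=b$, $x \ge 0$. Define $F : \mathbb{R}^{2n+m} \to \mathbb{R}^{2n+m}$ by $$ F(x,\lambda,z) = \begin{bmatrix} -Qx + A^T\lambda + z - c \\ Ax - b \\ XZe \end{bmatrix}, \qquad x,z\in\mathbb{R}^n,\ \lambda\in\mathbb{R}^m, $$ where $X = \mathrm{diag}(x)$, $Z = \mathrm{diag}(z)$ and $e$ is the vector of ones. Its Jacobian is $$ J(x,\lambda,z) = \begin{bmatrix} -Q & A^T & I \\ A & 0 & 0 \\ Z & 0 & X \end{bmatrix}. $$ Let $(x^j,\lambda^j,z^j)$, $j = 0,1,2,\dots$, be the iterates of a primal-dual interior point method (so $x^j, z^j > 0$ componentwise); write $J_j = J(x^j,\lambda^j,z^j)$, $X^j = \mathrm{diag}(x^j)$, $Z^j = \mathrm{diag}(z^j)$. The matrix $J_{k-\ell}$ is assumed nonsingular. For each $j$ set $$ s_j = \begin{bmatrix} s_{j,x} \\ s_{j,\lambda} \\ s_{j,z} \end{bmatrix} = \begin{bmatrix} x^{j+1}-x^j \\ \lambda^{j+1}-\lambda^j \\ z^{j+1}-z^j \end{bmatrix}, \qquad y_j = \begin{bmatrix} y_{j,c} \\ y_{j,b} \\ y_{j,\mu} \end{bmatrix} = F(x^{j+1},\lambda^{j+1},z^{j+1}) - F(x^j,\lambda^j,z^j),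 $$ with blocks of sizes $n, m, n$ for $s_j$ (in the order $x,\lambda,z$) and $n, m, n$ for $y_j$ (in the order $c,b,\mu$), so that $y_{j,\mu} = X^{j+1}Z^{j+1}e - X^jZ^je$. Set $\rho_j = y_j^T y_j$ (assumed nonzero for $j = k-\ell,\dots,k-1$) and $V_j = I - \frac{y_j y_j^T}{\rho_j}$. Products of matrices are ordered with increasing index from left to right, $\prod_{j=p}^{q} V_j = V_p V_{p+1}\cdots V_q$, and an empty product ($p > q$) is the identity matrix. *)

(* Defs.v *)
From mathcomp Require Import all_boot all_order all_algebra.
Set Implicit Arguments.
Unset Strict Implicit.
Unset Printing Implicit Defensive.
Import Order.TTheory GRing.Theory Num.Theory.
Local Open Scope ring_scope.

(* Vectors of R^(2n+m) are columns of height n + m + n, with the blocks in the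
   order x, lambda, z (arguments) or c, b, mu (values). *)

Definition block3 (R : realFieldType) (m n : nat)
    (u : 'cV[R]_n) (v : 'cV[R]_m) (w : 'cV[R]_n) : 'cV[R]_(n + m + n) :=
  col_mx (col_mx u v) w.

Definition block_x (R : realFieldType) (m n : nat)
    (u : 'cV[R]_(n + m + n)) : 'cV[R]_n := usubmx (usubmx u).

Definition block_z (R : realFieldType) (m n : nat)
    (u : 'cV[R]_(n + m + n)) : 'cV[R]_n := dsubmx u.

Definition diagc (R : realFieldType) (n : nat) (x : 'cV[R]_n) : 'M[R]_n :=
  diag_mx x^T.

Definition dotc (R : realFieldType) (p : nat) (u v : 'cV[R]_p) : R :=
  (u^T *m v) 0 0.

Definition kktF (R : realFieldType) (m n : nat)
    (Q : 'M[R]_n) (A : 'M[R]_(m, n)) (b : 'cV[R]_m) (c : 'cV[R]_n)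
    (x : 'cV[R]_n) (lam : 'cV[R]_m) (z : 'cV[R]_n) : 'cV[R]_(n + m + n) :=
  block3 (- (Q *m x) + A^T *m lam + z - c)
         (A *m x - b)
         (diagc x *m diagc z *m const_mx 1).

Definition kktJ (R : realFieldType) (m n : nat)
    (Q : 'M[R]_n) (A : 'M[R]_(m, n))
    (x : 'cV[R]_n) (lam : 'cV[R]_m) (z : 'cV[R]_n) : 'M[R]_(n + m + n) :=
  col_mx
    (col_mx (row_mx (row_mx (- Q)     A^T) 1%:M)
            (row_mx (row_mx A         0)   0))
            (row_mx (row_mx (diagc z) 0)   (diagc x)).

Definition step_s (R : realFieldType) (m n : nat)
    (x : nat -> 'cV[R]_n) (lam : nat -> 'cV[R]_m) (z : nat -> 'cV[R]_n)
    (j : nat) : 'cV[R]_(n + m + n) :=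
  block3 (x j.+1 - x j) (lam j.+1 - lam j) (z j.+1 - z j).

Definition step_y (R : realFieldType) (m n : nat)
    (Q : 'M[R]_n) (A : 'M[R]_(m, n)) (b : 'cV[R]_m) (c : 'cV[R]_n)
    (x : nat -> 'cV[R]_n) (lam : nat -> 'cV[R]_m) (z : nat -> 'cV[R]_n)
    (j : nat) : 'cV[R]_(n + m + n) :=
  kktF Q A b c (x j.+1) (lam j.+1) (z j.+1) - kktF Q A b c (x j) (lam j) (z j).

Definition rho (R : realFieldType) (p : nat) (y : nat -> 'cV[R]_p)
    (j : nat) : R := dotc (y j) (y j).

Definition projV (R : realFieldType) (p : nat) (y : nat -> 'cV[R]_p)
    (j : nat) : 'M[R]_p :=
  1%:M - (rho y j)^-1 *: (y j *m (y j)^T).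

(* The big operator multiplies by increasing index from left to right:
   V_(k-i+1) V_(k-i+2) ... V_(k-1), and is 1%:M when i = 1. *)
Definition alpha (R : realFieldType) (p : nat) (y : nat -> 'cV[R]_p)
    (k : nat) (v : 'cV[R]_p) (i : nat) : R :=
  dotc (y (k - i)%N)
       ((\big[mulmx/1%:M]_((k - i).+1 <= j < k) projV y j) *m v)
  / rho y (k - i)%N.

Definition broyden_bad (R : realFieldType) (p : nat)
    (s y : nat -> 'cV[R]_p) (j : nat) (H : 'M[R]_p) : 'M[R]_p :=
  H *m projV y j + (rho y j)^-1 *: (s j *m (y j)^T).

(* Main.v *)
(* The vector [J s_j - y_j] is the error of [s_j] in the secant equation of the
   Jacobian [J]; since the first two blocks of [F] are affine with the constant
   Jacobian blocks appearing in [J], only its last block can be nonzero.  As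
   [J H_(j+1) v = J H_j (V_j v) + (y_j^T v / rho_j) J s_j] and
   [V_j v = v - (y_j^T v / rho_j) y_j], each update adds one multiple of
   [J s_j - y_j] to [J H v] and replaces [v] by [V_j v] in the earlier ones. *)
Require Import Defs.
From HB Require Import structures.
From mathcomp Require Import all_boot all_order all_algebra.
From mathcomp Require Import ring.
Set Implicit Arguments.
Unset Strict Implicit.
Unset Printing Implicit Defensive.
Import Order.TTheory GRing.Theory Num.Theory.
Local Open Scope ring_scope.

(** The monoid law lets [big_nat_recr] split the ordered product of the [projV y j] in [alpha]. *)
HB.instance Definition _ (R : pzSemiRingType) (p : nat) :=
  Monoid.isLaw.Build 'M[R]_p 1%:M mulmx (@mulmxA R p p p p)
    (@mul1mx R p p) (@mulmx1 R p p).

Lemma mulmx_projV (R : realFieldType) (p : nat) (y : nat -> 'cV[R]_p) (j : nat)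
    (v : 'cV[R]_p) :
  projV y j *m v = v - (dotc (y j) v / rho y j) *: y j.
Proof.
rewrite /projV mulmxBl mul1mx -scalemxAl -mulmxA [_^T *m v]mx11_scalar.
by rewrite mul_mx_scalar scalerA mulrC.
Qed.

Lemma alpha1 (R : realFieldType) (p : nat) (y : nat -> 'cV[R]_p) (k : nat)
    (v : 'cV[R]_p) :
  alpha y k.+1 v 1 = dotc (y k) v / rho y k.
Proof. by rewrite /alpha subSS subn0 big_geq // mul1mx. Qed.

(** The rightmost factor [projV y k] acts on [v] first, so it can be absorbed into the vector;
    [0 < i] ensures that the product contains it. *)
Lemma alphaS (R : realFieldType) (p : nat) (y : nat -> 'cV[R]_p) (k i : nat)
    (v : 'cV[R]_p) :
  (0 < i <= k)%N -> alpha y k.+1 v i.+1 = alpha y k (projV y k *m v) i.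
Proof.
case/andP=> i_gt0 le_ik; rewrite /alpha subSS big_nat_recr /= ?mulmxA //.
by rewrite ltn_subrL i_gt0 (leq_trans i_gt0 le_ik).
Qed.

Lemma mulmx_broyden_bad (R : realFieldType) (p : nat)
    (s y : nat -> 'cV[R]_p) (j : nat) (H : 'M[R]_p) (v : 'cV[R]_p) :
  broyden_bad s y j H *m v =
    H *m (projV y j *m v) + (dotc (y j) v / rho y j) *: s j.
Proof.
rewrite /broyden_bad mulmxDl -mulmxA -scalemxAl -mulmxA.
by rewrite [_^T *m v]mx11_scalar mul_mx_scalar scalerA [_^-1 * _]mulrC.
Qed.

(** Induction on the number of updates from the fixed start [k0], peeling off the last one. The
    vector [v] stays general because the earlier updates act on [projV y (k0 + l) *m v]. *)
Lemma mulmx_broyden_bad_iter (R : realFieldType) (p : nat)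
    (s y : nat -> 'cV[R]_p) (J : 'M[R]_p) (H : nat -> 'M[R]_p) (k0 l : nat)
    (v : 'cV[R]_p) :
  J *m H k0 = 1%:M ->
  (forall j, (k0 <= j < k0 + l)%N -> H j.+1 = broyden_bad s y j (H j)) ->
  J *m (H (k0 + l)%N *m v) =
    v + \sum_(1 <= i < l.+1) alpha y (k0 + l) v i *:
          (J *m s (k0 + l - i)%N - y (k0 + l - i)%N).
Proof.
move=> JH0; elim: l v => [|l IHl] v H_step.
  by rewrite addn0 big_geq // addr0 mulmxA JH0 mul1mx.
rewrite addnS H_step ?addnS ?leq_addr ?ltnSn // mulmx_broyden_bad mulmxDr.
rewrite IHl => [|j /andP[le_k0j lt_jkl]]; last first.
  by rewrite H_step // le_k0j addnS ltnW.
(* The term [i = 1] belongs to the last update; the others, shifted by one, are those of the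
   induction hypothesis. *)
rewrite [in RHS]big_nat_recl // alpha1 subSS subn0 -scalemxAr.
have -> : \sum_(1 <= i < l.+1) alpha y (k0 + l).+1 v i.+1 *:
            (J *m s ((k0 + l).+1 - i.+1)%N - y ((k0 + l).+1 - i.+1)%N) =
          \sum_(1 <= i < l.+1) alpha y (k0 + l) (projV y (k0 + l) *m v) i *:
            (J *m s (k0 + l - i)%N - y (k0 + l - i)%N).
  apply: eq_big_nat => i /andP[i_gt0 le_il].
  by rewrite alphaS ?subSS // i_gt0 (leq_trans (le_il : i <= l)%N) ?leq_addl.
(* Only the free-standing projected vector is expanded: its multiple of [y] completes [J *m s] to
   the secant error. *)
rewrite {1}mulmx_projV scalerBr -!addrA; congr (v + _).
by rewrite addrC -addrA addrC -!addrA.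
Qed.

(** The base point is arbitrary, since it enters only the third block row; one Jacobian thus serves
    all steps [j]. *)
Lemma kktJ_secant_error (R : realFieldType) (m n : nat)
    (Q : 'M[R]_n) (A : 'M[R]_(m, n)) (b : 'cV[R]_m) (c : 'cV[R]_n)
    (x : nat -> 'cV[R]_n) (lam : nat -> 'cV[R]_m) (z : nat -> 'cV[R]_n)
    (x0 : 'cV[R]_n) (lam0 : 'cV[R]_m) (z0 : 'cV[R]_n) (j : nat) :
  let s := step_s x lam z j in
  let y := step_y Q A b c x lam z j in
  kktJ Q A x0 lam0 z0 *m s - y =
    block3 0 0 (diagc z0 *m block_x s + diagc x0 *m block_z s - block_z y).
Proof.
rewrite /= /step_s /step_y /kktJ /kktF /block_x /block_z /block3.
rewrite !mul_col_mx !mul_row_col !(opp_col_mx, add_col_mx, col_mxKu, col_mxKd).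
rewrite !(mul0mx, mul1mx, addr0); congr (col_mx (col_mx _ _) _).
- rewrite !(mulmxBr, mulNmx); apply/matrixP=> i i'; rewrite !mxE; ring.
- rewrite mulmxBr; apply/matrixP=> i i'; rewrite !mxE; ring.
Qed.

Lemma block3_lin (R : realFieldType) (m n : nat) (I : Type) (r : seq I)
    (a : I -> R) (w : I -> 'cV[R]_n) :
  \sum_(i <- r) a i *: block3 (0 : 'cV[R]_n) (0 : 'cV[R]_m) (w i) =
    block3 0 0 (\sum_(i <- r) a i *: w i).
Proof.
rewrite /block3; elim/big_rec2: _ => [|i u w' _ ->]; first by rewrite !col_mx0.
by rewrite !scale_col_mx !add_col_mx !scaler0 !addr0.
Qed.

Theorem lemma2 (R : realFieldType) (m n : nat)
    (Q : 'M[R]_n) (A : 'M[R]_(m, n)) (b : 'cV[R]_m) (c : 'cV[R]_n)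
    (A_free : row_free A)
    (x : nat -> 'cV[R]_n) (lam : nat -> 'cV[R]_m) (z : nat -> 'cV[R]_n)
    (x_gt0 : forall j i, 0 < x j i 0) (z_gt0 : forall j i, 0 < z j i 0)
    (k l : nat) (le_lk : (l <= k)%N)
    (J : 'M[R]_(n + m + n))
    (J_def : J = kktJ Q A (x (k - l)%N) (lam (k - l)%N) (z (k - l)%N))
    (J_unit : J \in unitmx)
    (s y : nat -> 'cV[R]_(n + m + n))
    (s_def : forall j, s j = step_s x lam z j)
    (y_def : forall j, y j = step_y Q A b c x lam z j)
    (rho_neq0 : forall j, (k - l <= j < k)%N -> rho y j != 0)
    (H : nat -> 'M[R]_(n + m + n))
    (H_init : H (k - l)%N = invmx J)
    (H_step : forall j, (k - l <= j < k)%N ->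
       H j.+1 = broyden_bad s y j (H j))
    (v r : 'cV[R]_(n + m + n)) :
  r = H k *m v <->
  J *m r =
    v + block3 0 0
          (\sum_(1 <= i < l.+1) alpha y k v i *:
             (diagc (z (k - l)%N) *m block_x (s (k - i)%N)
              + diagc (x (k - l)%N) *m block_z (s (k - i)%N)
              - block_z (y (k - i)%N))).
Proof.
have JH : J *m (H k *m v) = v + block3 0 0
    (\sum_(1 <= i < l.+1) alpha y k v i *:
       (diagc (z (k - l)%N) *m block_x (s (k - i)%N)
        + diagc (x (k - l)%N) *m block_z (s (k - i)%N)
        - block_z (y (k - i)%N))).
  have := @mulmx_broyden_bad_iter _ _ s y J H (k - l) l v.
  rewrite subnK // H_init mulmxV // => -> //; rewrite -block3_lin.
  congr (v + _); apply: eq_bigr => i _.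
  by rewrite J_def s_def y_def kktJ_secant_error.
(* [H k *m v] solves the system; invertibility of [J] makes it the only solution. *)
rewrite -JH; split=> [-> // | /(congr1 (mulmx (invmx J)))].
by rewrite !mulKmx.
Qed.
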